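(* Let $s(n)$ be a real-valued function on the natural numbers with $s(n)\to\infty$ and $s(n)=o(n)$ as $n\to\infty$. Then there exists a constant $C$ (which may depend on the function $s$) such that the following holds: if $A\subseteq V(Q_n)$ with $|A|=n$ and $|\Gamma(A)|\le\binom{n}{2}+n\,s(n)$, then there exists some $w\in V(Q_n)$ for which $|\Gamma(w)\cap A|\ge n-C\,s(n)$.
   Context: $Q_n$ is the $n$-dimensional hypercube: vertex set $\{0,1\}^n$, two vertices adjacent iff they differ in exactly one coordinate. $\Gamma(v)$ is the set of neighbours of $v$ in $Q_n$, and $\Gamma(A)=\bigcup_{v\in A}\Gamma(v)$. The constant $C$ does not depend on $n$ or $A$. *)

(* Defs.v *)
From mathcomp Require Import all_boot all_order all_algebra.
From mathcomp Require Import all_classical all_reals all_analysis.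
Set Implicit Arguments.
Unset Strict Implicit.
Unset Printing Implicit Defensive.

Definition cube (n : nat) := {ffun 'I_n -> bool}.

Definition cube_adj (n : nat) (u v : cube n) : bool :=
  #|[set i : 'I_n | u i != v i]| == 1.

Definition nbr (n : nat) (v : cube n) : {set cube n} :=
  [set u : cube n | cube_adj v u].

Definition nbrs (n : nat) (A : {set cube n}) : {set cube n} :=
  \bigcup_(v in A) nbr v.

(* Main.v *)
(**
Cutting the cube along a coordinate that splits [A], of size [k], into parts of
sizes [k1] and [k0] gives by induction |Gamma(A)| >= k n + 1 - C(k+1, 2); for
|A| = n, the cut improves this bound by (k1 - 1)(k0 - 1).  Hence, if |Gamma(A)|
is at most C(n, 2) + n s, every coordinate is constant on [A] up to [O(s)]
points.  Let [w] be the vector of majority values.  Two points of the cube have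
common neighbours (exactly two) only at distance 2, and a point of [A] other
than [w] and its neighbours has only [O(s)] points of [A] at distance 2, since
such a point differs from [w] at one of two prescribed coordinates, with one
exception.  With [b] points of [A] not adjacent to [w], Bonferroni's inequality
at the vertices other than [w] then gives |Gamma(A)| >= C(n, 2) + b n / 2 -
O(b s + n), so b = O(s).  For small [n] it is enough that s n > 0, which holds
because |Gamma(A)| > C(n, 2).
*)
Require Import Defs.
From mathcomp Require Import all_boot all_order all_algebra.
From mathcomp Require Import zify lra.
Import Order.TTheory GRing.Theory Num.Theory.

Set Implicit Arguments.
Unset Strict Implicit.

Section Cube.
Context {n : nat}.
Implicit Types (u v w x y : cube n) (A : {set cube n}) (S : {set 'I_n}).

(** * Coordinate flips and neighbourhoods *)

Definition diff_set u v : {set 'I_n} := [set i | u i != v i].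

Definition flip v (i : 'I_n) : cube n := [ffun j => v j (+) (j == i)].

Lemma flip_inj v : injective (flip v).
Proof.
move=> i j /ffunP/(_ i); rewrite !ffunE eqxx.
by have [->|_] := eqVneq i j; case: (v i).
Qed.

Lemma diff_setC u v : diff_set u v = diff_set v u.
Proof. by apply/setP => i; rewrite !inE eq_sym. Qed.

Lemma diff_set_flip v i : diff_set v (flip v i) = [set i].
Proof. by apply/setP => j; rewrite !inE ffunE; case: (v j); case: (j == i). Qed.

Lemma diff_set1 u v i : diff_set u v = [set i] -> v = flip u i.
Proof.
move=> /setP D; apply/ffunP => j; rewrite ffunE.
by have := D j; rewrite !inE => <-; case: (u j); case: (v j).
Qed.

Lemma cube_adjP u v : reflect (exists i, v = flip u i) (cube_adj u v).
Proof.
apply: (iffP cards1P) => [[i Di]|[i ->]]; exists i; last exact: diff_set_flip.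
exact: diff_set1.
Qed.

Lemma cube_adjC u v : cube_adj u v = cube_adj v u.
Proof. by rewrite /cube_adj -/(diff_set u v) diff_setC. Qed.

Lemma nbrE v : nbr v = [set flip v i | i : 'I_n].
Proof.
apply/setP => u; rewrite inE; apply/cube_adjP/imsetP.
  by case=> i ->; exists i.
by case=> i _ ->; exists i.
Qed.

Lemma card_nbr v : #|nbr v| = n.
Proof. by rewrite nbrE card_imset ?card_ord //; apply: flip_inj. Qed.

(** * Lower bounds on neighbourhoods by cutting along a coordinate *)

(** Restricting the directions lets the induction drop a coordinate without leaving [cube n]. *)
Definition nbrs_in S A : {set cube n} := [set flip v i | v in A, i in S].

Lemma nbrs_in_setT A : nbrs_in [set: 'I_n] A = nbrs A.
Proof.
apply/setP => u; apply/imset2P/bigcupP.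
  by case=> v i vA _ ->; exists v => //; rewrite nbrE imset_f.
by case=> v vA; rewrite nbrE => /imsetP[i _ ->]; exists v i; rewrite ?inE.
Qed.

Lemma card_split_coord A i :
  #|[set v in A | v i]| + #|[set v in A | ~~ v i]| = #|A|.
Proof.
rewrite -[RHS](cardsID [set v : cube n | v i]).
by congr (_ + _); apply: eq_card => v; rewrite !inE // andbC.
Qed.

(* Moves in the directions of [S :\ i] do not change coordinate [i], so the two
   halves of [A] have disjoint neighbourhoods. *)
Lemma nbrs_in_split S A i :
  #|nbrs_in (S :\ i) [set v in A | v i]|
    + #|nbrs_in (S :\ i) [set v in A | ~~ v i]| <= #|nbrs_in S A|.
Proof.
rewrite -[leqRHS](cardsID [set v : cube n | v i]).
apply: leq_add; apply: subset_leq_card; apply/subsetP => u /imset2P[v j].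
  rewrite !inE => /andP[vA vi] /andP[ji jS] ->.
  by rewrite ffunE eq_sym (negbTE ji) addbF vi andbT imset2_f ?inE ?vA ?ji.
rewrite !inE => /andP[vA vi] /andP[ji jS] ->.
by rewrite ffunE eq_sym (negbTE ji) addbF vi imset2_f ?inE ?vA ?ji.
Qed.

Lemma bin2D a b : 'C((a + b).+1, 2) = 'C(a.+1, 2) + 'C(b.+1, 2) + a * b.
Proof.
elim: b => [|b IH]; first by rewrite addn0 muln0 (bin_small (ltnSn 1)) !addn0.
by rewrite addnS (binS _ 1) IH (binS b.+1 1) !bin1; lia.
Qed.

Definition nbrs_in_bound S A :=
  #|A| * #|S| + 1 <= #|nbrs_in S A| + 'C(#|A|.+1, 2).

(** The bounds for the halves add up. By [bin2D] the binomial of the whole exceeds those of the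
    halves by the product term; losing direction [i] costs [#|A|]. *)
Lemma nbrs_in_split_bound S A i : i \in S ->
    nbrs_in_bound (S :\ i) [set v in A | v i] ->
    nbrs_in_bound (S :\ i) [set v in A | ~~ v i] ->
  #|A| * #|S| + #|[set v in A | v i]| * #|[set v in A | ~~ v i]| + 2
    <= #|nbrs_in S A| + 'C(#|A|.+1, 2) + #|A|.
Proof.
rewrite /nbrs_in_bound -(card_split_coord A i) bin2D (cardsD1 i S) => -> /=.
have := nbrs_in_split S A i.
move: #|nbrs_in _ [set x in A | x i]| #|nbrs_in _ [set x in A | ~~ x i]| => g1 g0.
move: #|[set x in A | x i]| #|[set x in A | ~~ x i]| #|_ :\ _| => k1 k0 m.
by move: #|_| 'C(_, _) 'C(_, _) => g c1 c0; nia.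
Qed.

(** Induction on [#|S|]. As [A] is constant off [S], a coordinate separating two of its points lies
    in [S] and can be cut. A single point gives equality. *)
Lemma nbrs_in_lower_bound S A :
    0 < #|A| ->
    {in A &, forall u v i, i \notin S -> u i = v i} ->
  nbrs_in_bound S A.
Proof.
elim: {S}_.+1 {-2}S (ltnSn #|S|) A => // m IH S leSm A A0 AS.
have [/cards1P[v ->]|A1] := boolP (#|A| == 1).
  have E : nbrs_in S [set v] = [set flip v i | i in S] by exact: imset2_set1l.
  rewrite /nbrs_in_bound E cards1 card_imset ?binn ?mul1n //; exact: flip_inj.
have /card_gt1P[u [v [uA vA uv]]] : 1 < #|A| by rewrite ltn_neqAle eq_sym A1.
have [i uvi] : exists i, u i != v i.
  apply/existsP; apply: contraNT uv; rewrite negb_exists => /forallP E.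
  by apply/eqP/ffunP => i; apply/eqP; rewrite -[_ == _]negbK E.
have iS : i \in S by apply: contraNT uvi => /(AS u v uA vA) ->.
have IHi (P : pred (cube n)) : 0 < #|[set x in A | P x]| ->
    (forall x y, P x -> P y -> x i = y i) ->
  nbrs_in_bound (S :\ i) [set x in A | P x].
  move=> A'0 Pi; apply: IH => //; first by rewrite [#|S|](cardsD1 i) iS in leSm.
  move=> x y; rewrite !inE => /andP[xA xP] /andP[yA yP] j.
  rewrite !inE negb_and negbK => /orP[/eqP ->|]; [exact: Pi|exact: AS].
have A1_gt0 : 0 < #|[set x in A | x i]|.
  apply/card_gt0P; case ui : (u i) uvi; first by exists u; rewrite !inE uA ui.
  by exists v; rewrite !inE vA; case: (v i) uvi.
have A0_gt0 : 0 < #|[set x in A | ~~ x i]|.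
  apply/card_gt0P; case ui : (u i) uvi; last by exists u; rewrite !inE uA ui.
  by exists v; rewrite !inE vA; case: (v i) uvi.
have bound1 : nbrs_in_bound (S :\ i) [set x in A | x i].
  by apply: (IHi (fun x => x i)) => // x y -> ->.
have bound0 : nbrs_in_bound (S :\ i) [set x in A | ~~ x i].
  by apply: (IHi (fun x => ~~ x i)) => // x y /negbTE -> /negbTE ->.
(* Both halves are nonempty, so [k1 * k0 + 1 >= k1 + k0], which absorbs the loss [#|A|]. *)
have := nbrs_in_split_bound iS bound1 bound0.
rewrite /nbrs_in_bound -(card_split_coord A i); move: A1_gt0 A0_gt0.
move: #|[set x in A | x i]| #|[set x in A | ~~ x i]| => k1 k0.
by move: #|S| #|_| 'C(_, _) => {iS} *; nia.
Qed.

Lemma nbrs_lower_bound A :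
  0 < #|A| -> #|A| * n + 1 <= #|nbrs A| + 'C(#|A|.+1, 2).
Proof.
move=> A_gt0; have := @nbrs_in_lower_bound [set: 'I_n] A A_gt0.
rewrite /nbrs_in_bound nbrs_in_setT cardsT card_ord; apply=> x y _ _ i.
by rewrite in_setT.
Qed.

Lemma nbrs_split_bound A i :
    0 < #|[set v in A | v i]| -> 0 < #|[set v in A | ~~ v i]| ->
  #|A| * n + #|[set v in A | v i]| * #|[set v in A | ~~ v i]| + 2
    <= #|nbrs A| + 'C(#|A|.+1, 2) + #|A|.
Proof.
move=> A1_gt0 A0_gt0; rewrite -nbrs_in_setT -[X in _ * X]card_ord -cardsT.
apply: nbrs_in_split_bound; first by rewrite inE.
  apply: nbrs_in_lower_bound => // x y.
  rewrite !inE => /andP[_ xi] /andP[_ yi] j.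
  by rewrite !inE andbT negbK => /eqP ->; rewrite xi yi.
apply: nbrs_in_lower_bound => // x y.
rewrite !inE => /andP[_ /negbTE xi] /andP[_ /negbTE yi] j.
by rewrite !inE andbT negbK => /eqP ->; rewrite xi yi.
Qed.

(** * Common neighbours and distance 2 *)

Lemma common_nbr_card2 u x y :
  x != y -> cube_adj x u -> cube_adj y u -> #|diff_set x y| = 2.
Proof.
move=> xy /cube_adjP[i ux]; rewrite cube_adjC => /cube_adjP[j yu].
have ij : i != j.
  apply: contraNneq xy => ij; apply/eqP/ffunP => l.
  by rewrite yu ux ij !ffunE -addbA addbb addbF.
rewrite (_ : diff_set x y = [set i; j]) ?cards2 ?ij //.
apply/setP => l; rewrite !inE yu ux !ffunE.
have [->|] := eqVneq l i; first by rewrite (negbTE ij); case: (x i).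
by case: (x l); case: (l == j).
Qed.

Lemma common_nbr_sub x y :
  x != y -> nbr x :&: nbr y \subset [set flip x i | i in diff_set x y].
Proof.
move=> xy; apply/subsetP => u; rewrite !inE => /andP[].
move=> /cube_adjP[i ux]; rewrite cube_adjC => /cube_adjP[j yu].
rewrite ux imset_f // inE yu ux !ffunE eqxx.
have [ij|] := eqVneq i j; last by case: (x i).
case/eqP: xy; apply/ffunP => l.
by rewrite yu ux ij !ffunE -addbA addbb addbF.
Qed.

Lemma card_common_nbr x y :
  x != y -> #|nbr x :&: nbr y| <= 2 * (#|diff_set x y| == 2).
Proof.
move=> xy; have [D2|D2] := eqVneq.
  rewrite (leq_trans (subset_leq_card (common_nbr_sub xy))) //.
  by rewrite (leq_trans (leq_imset_card _ _)) ?D2.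
rewrite leqn0 cards_eq0; apply/eqP/setP => u; rewrite !inE.
by apply/negP => /andP[xu yu]; rewrite (common_nbr_card2 xy xu yu) in D2.
Qed.

(** Of the at most two common neighbours, [w] is one. *)
Lemma card_common_nbrD1 w x y : x != y -> cube_adj w x -> cube_adj w y ->
  #|nbr x :&: nbr y :\ w| <= 1.
Proof.
move=> xy wx wy; have := card_common_nbr xy.
rewrite (cardsD1 w) !inE cube_adjC wx cube_adjC wy.
by case: eqP => //= _; lia.
Qed.

(* [y] either differs from [w] at one of two given coordinates where [x] does,
   or is determined: it is [x] with these two coordinates flipped. *)
Lemma card_dist2 A w x t : x != w -> ~~ cube_adj w x ->
    (forall i, #|[set v in A | v i != w i]| <= t) ->
  #|[set y in A | #|diff_set x y| == 2]| <= 2 * t + 1.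
Proof.
move=> xw nwx At.
have /card_gt1P[i [j [iD jD ij]]] : 1 < #|diff_set w x|.
  have : #|diff_set w x| != 0.
    apply: contraNneq xw => /eqP; rewrite cards_eq0 => /eqP/setP D0.
    apply/eqP/ffunP => l; have := D0 l; rewrite !inE => /negbFE/eqP.
    exact: esym.
  by move: nwx; rewrite /cube_adj -/(diff_set w x); case: #|_| => [|[|]].
pose z := flip (flip x i) j.
apply: (@leq_trans #|[set v in A | v i != w i] :|: [set v in A | v j != w j]
                     :|: [set z]|); last first.
  rewrite (leq_trans (leq_card_setU _ _)) // cards1 leq_add2r.
  rewrite (leq_trans (leq_card_setU _ _)) // mul2n -addnn leq_add //.
apply/subset_leq_card/subsetP => y; rewrite !inE => /andP[yA /eqP D2].
rewrite yA /=; apply/orP.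
have [yi|yi] := eqVneq (y i) (w i); last by left.
have [yj|yj] := eqVneq (y j) (w j); last by left.
right; rewrite !inE in iD jD.
have D : diff_set x y = [set i; j].
  apply/eqP; rewrite eq_sym eqEcard cards2 ij D2 leqnn andbT.
  by rewrite subUset !sub1set !inE yi yj eq_sym iD eq_sym jD.
apply/eqP/ffunP => l; rewrite !ffunE.
move/setP/(_ l): D; rewrite !inE.
have [->|_] := eqVneq l i; first by rewrite (negbTE ij); case: (x i); case: (y i).
by case: (l == j); case: (x l); case: (y l).
Qed.

(** * Double counting of adjacencies and common neighbours *)

Lemma sum_adj A u : \sum_(x in A) cube_adj u x = #|nbr u :&: A|.
Proof.
rewrite -sum1_card big_mkcond [RHS]big_mkcond; apply: eq_bigr => x _.
by rewrite !inE; case: (x \in A); case: cube_adj.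
Qed.

Lemma sum_card_nbrI A : \sum_u #|nbr u :&: A| = #|A| * n.
Proof.
under eq_bigr do rewrite -sum_adj.
rewrite exchange_big /= -sum_nat_const; apply: eq_bigr => x _.
transitivity (\sum_(u in [set: cube n]) cube_adj x u).
  by apply: eq_big => [u|u _]; rewrite ?inE // cube_adjC.
by rewrite sum_adj setIT card_nbr.
Qed.

Lemma sum_adj_pairs A u :
  \sum_(x in A) \sum_(y in A | y != x) (cube_adj u x && cube_adj u y)
    = #|nbr u :&: A| * #|nbr u :&: A|.-1.
Proof.
rewrite -{1}sum_adj big_distrl /=; apply: eq_bigr => x xA.
case ux : (cube_adj u x); rewrite /= ?mul1n ?mul0n; last by rewrite big1.
by rewrite -sum_adj [in RHS](bigD1 x) //= ux add1n.
Qed.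

(** Both sides count triples of an ordered pair of distinct points of [A] and a common neighbour
    other than [w]. *)
Lemma sum_card_common_nbr A w :
  \sum_(u | u != w) #|nbr u :&: A| * #|nbr u :&: A|.-1
    = \sum_(x in A) \sum_(y in A | y != x) #|nbr x :&: nbr y :\ w|.
Proof.
under eq_bigr do rewrite -sum_adj_pairs.
rewrite exchange_big /=; apply: eq_bigr => x _.
rewrite exchange_big /=; apply: eq_bigr => y _.
rewrite -sum1_card big_mkcond [RHS]big_mkcond; apply: eq_bigr => u _.
rewrite !inE (cube_adjC u x) (cube_adjC u y).
by case: (u != w); case: (cube_adj x u); case: (cube_adj y u).
Qed.

(** [card_dist2] handles each [x] other than [w]; the final [#|A|] pays for [x = w]. *)
Lemma sum_dist2 A w t : (forall i, #|[set v in A | v i != w i]| <= t) ->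
  \sum_(x in A) \sum_(y in A | y != x)
      (~~ cube_adj w x && (#|diff_set x y| == 2))
    <= #|A :\: nbr w| * (2 * t + 1) + #|A|.
Proof.
move=> At.
apply: (@leq_trans (\sum_(x in A) (~~ cube_adj w x * (2 * t + 1) +
                                  (x == w) * #|A|))).
  apply: leq_sum => x xA.
  case wx : (cube_adj w x); first by rewrite big1.
  apply: (@leq_trans #|[set y in A | #|diff_set x y| == 2]|).
    rewrite -sum1_card big_mkcond [leqRHS]big_mkcond; apply: leq_sum => y _.
    by rewrite !inE; case: (y \in A); case: (y != x); case: (_ == 2).
  have [_|xw] := eqVneq x w.
    rewrite mul1n mul1n (leq_trans _ (leq_addl _ _)) //.
    by apply: subset_leq_card; apply/subsetP => y; rewrite inE => /andP[].
  by rewrite mul1n mul0n addn0 (card_dist2 xw) ?wx.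
rewrite big_split /= -!big_distrl /= leq_add //.
  rewrite leq_mul2r; apply/orP; right.
  rewrite -sum1_card big_mkcond [leqRHS]big_mkcond; apply: leq_sum => y _.
  by rewrite !inE; case: (y \in A); case: cube_adj.
rewrite -[leqRHS]mul1n leq_mul2r; apply/orP; right.
have [wA|wA] := boolP (w \in A).
  rewrite (bigD1 w) //= eqxx big1 // => x /andP[_].
  by case: (x == w).
rewrite big1 // => x xA; apply/eqP; rewrite eqb0.
by apply: contraNneq wA => <-.
Qed.

Lemma sum_card_common_nbr_le A w t :
    (forall i, #|[set v in A | v i != w i]| <= t) ->
  \sum_(u | u != w) #|nbr u :&: A| * #|nbr u :&: A|.-1
    <= #|nbr w :&: A| * #|nbr w :&: A|.-1
       + 4 * (#|A :\: nbr w| * (2 * t + 1) + #|A|).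
Proof.
move=> At; rewrite sum_card_common_nbr -sum_adj_pairs.
pose F x y : nat := ~~ cube_adj w x && (#|diff_set x y| == 2).
have sumFC : \sum_(x in A) \sum_(y in A | y != x) F y x
             = \sum_(x in A) \sum_(y in A | y != x) F x y.
  rewrite (exchange_big_dep (fun y => y \in A)) /=; last by move=> x y _ /andP[].
  apply: eq_bigr => x xA; apply: eq_bigl => y.
  by rewrite xA eq_sym.
have := sum_dist2 At; rewrite -/F => le_F.
(* A pair inside [nbr w] has at most one common neighbour besides [w]. Any other pair has at most
   two, charged to a member not adjacent to [w]; the two orders make the factor 4. *)
apply: (@leq_trans (\sum_(x in A) \sum_(y in A | y != x)
   ((cube_adj w x && cube_adj w y) + (2 * F x y + 2 * F y x)))).
  apply: leq_sum => x xA; apply: leq_sum => y /andP[yA]; rewrite eq_sym => xy.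
  have := card_common_nbrD1 xy; have := card_common_nbr xy => c2 /(_ w) c1.
  have := leq_trans (subset_leq_card (subsetDl _ [set w])) c2.
  rewrite /F (diff_setC y x) => c3.
  case: (cube_adj w x) (cube_adj w y) c1 => [] [] //= c1;
    first exact: leq_trans (c1 isT isT) _;
    by rewrite (leq_trans c3) // add0n ?leq_addl ?leq_addr.
under eq_bigr do rewrite big_split /= big_split /= -!big_distrr /=.
rewrite big_split /= big_split /= -!big_distrr /= sumFC leq_add2l.
by rewrite addnn -mul2n mulnA leq_mul2l le_F.
Qed.

(* Bonferroni's inequality at every vertex [u != w]; [w] itself covers all its
   neighbours in [A] at once. *)
Lemma card_nbrs_bonferroni A w :
  2 * (#|A| * n) <= 2 * #|nbrs A| + 2 * #|nbr w :&: A|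
    + \sum_(u | u != w) #|nbr u :&: A| * #|nbr u :&: A|.-1.
Proof.
rewrite -sum_card_nbrI (bigD1 w) //= mulnDr -addnA addnCA leq_add2l.
apply: (@leq_trans (\sum_(u | u != w) (2 * (u \in nbrs A) +
                      #|nbr u :&: A| * #|nbr u :&: A|.-1))).
  rewrite big_distrr; apply: leq_sum => u _ /=.
  case: (boolP (u \in nbrs A)) => uA.
    (* With [d] neighbours in [A], this is [(d - 1) (d - 2) >= 0]. *)
    by move: #|_| => [|[|[|k]]] //=; nia.
  suff -> : nbr u :&: A = set0 by rewrite cards0.
  apply/setP => x; rewrite !inE; apply/negP => /andP[ux xA].
  by case/negP: uA; apply/bigcupP; exists x; rewrite // inE cube_adjC.
rewrite big_split /= leq_add2r -big_distrr leq_mul2l /=.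
rewrite -sum1_card big_mkcond [leqRHS]big_mkcond; apply: leq_sum => u _.
by case: (u != w); case: (u \in _).
Qed.

Lemma card_nbrs_lower_bound A w t :
    (forall i, #|[set v in A | v i != w i]| <= t) ->
  2 * (#|A| * n) <= 2 * #|nbrs A| + #|nbr w :&: A| * (#|nbr w :&: A|).+1
    + 4 * (#|A :\: nbr w| * (2 * t + 1) + #|A|).
Proof.
move=> At; have := sum_card_common_nbr_le At; have := card_nbrs_bonferroni A w.
move: (\sum_(u | _) _) => s.
by case: #|nbr w :&: A| => [|a] /=; nia.
Qed.

(** * The majority vector *)

Lemma mul2_bin2S m : 2 * 'C(m.+1, 2) = m.+1 * m.
Proof. by rewrite -mul_bin_diag bin1. Qed.

Definition majority A : cube n := [ffun i => #|A| < 2 * #|[set v in A | v i]|].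

(** The larger half has at least [#|A| / 2] points, so twice [k1 * k0] is at least the minority
    times [#|A|]. With an empty minority there is no cut and [nbrs_lower_bound] suffices. *)
Lemma card_minority A i : 0 < #|A| ->
  #|[set v in A | v i != majority A i]| * #|A| + 2 * (#|A| * n)
    <= 2 * #|nbrs A| + #|A|.+1 * #|A| + 2 * #|A|.
Proof.
move=> A_gt0; have := nbrs_lower_bound A_gt0; have := @nbrs_split_bound A i.
have E b : #|[set v in A | v i != b]|
           = if b then #|[set v in A | ~~ v i]| else #|[set v in A | v i]|.
  by case: b; apply: eq_card => v; rewrite !inE; case: (v i).
rewrite E -mul2_bin2S ffunE -(card_split_coord A i); move: #|nbrs A| 'C(_, _).
move: #|[set v in A | v i]| #|[set v in A | ~~ v i]| => k1 k0 g c.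
move=> split_bound bound; have [k1_big|k1_small] := ltnP.
  have [->|k0_gt0] := posnP k0; first by nia.
  have {split_bound} := split_bound _ k0_gt0; nia.
have [->|k1_gt0] := posnP k1; first by nia.
have [k0_0|k0_gt0] := posnP k0; first by nia.
have := split_bound k1_gt0 k0_gt0; nia.
Qed.

Lemma bin2_lt_card_nbrs A :
  0 < n -> #|A| = n -> 'C(n, 2) < #|nbrs A|.
Proof.
move=> n_gt0 cA; have := @nbrs_lower_bound A; rewrite cA binS bin1.
have := mul2_bin2S n.-1; rewrite prednK //; move=> bin2 /(_ n_gt0); nia.
Qed.

End Cube.

(** * The centre for large [n] *)

Local Open Scope ring_scope.

Lemma exists_center (R : realFieldType) (sigma : R) (n : nat) (A : {set cube n}) :
    1 <= sigma -> 64 * sigma <= n%:R -> #|A| = n ->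
    #|nbrs A|%:R <= 'C(n, 2)%:R + n%:R * sigma ->
  n%:R - 20 * sigma <= #|nbr (majority A) :&: A|%:R.
Proof.
move=> s_ge1 s_le cA le_g.
have n_gt0 : (0 < n)%N by rewrite -(ltr_nat R); lra.
pose k i := #|[set v in A | v i != majority A i]|.
have [j kj] : {j | (\max_i k i)%N = k j} by apply: bigop.eq_bigmax; rewrite card_ord.
have kt i : (k i <= k j)%N by rewrite -kj leq_bigmax.
have := card_nbrs_lower_bound kt; rewrite cA.
have := @card_minority _ A j; rewrite cA => /(_ n_gt0); rewrite -/(k j).
have := cardsID (nbr (majority A)) A; rewrite cA setIC.
have n2 : 2 * 'C(n, 2)%:R = n%:R * (n%:R - 1) :> R.
  by case: n n_gt0 {A s_le cA le_g k j kj kt} => // n _;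
    rewrite -natrM mul2_bin2S natrM -[n.+1%:R]natr1 addrK.
move: #|_ :&: _| #|_ :\: _| #|nbrs A| (k j) le_g => a b g t le_g eq_ab.
rewrite -!(ler_nat R) !(natrM, natrD) -[n.+1%:R]natr1 -[a.+1%:R]natr1 => le_t le_n.
have {eq_ab} : a%:R + b%:R = n%:R :> R by rewrite -natrD eq_ab.
have : 0 < n%:R :> R by rewrite ltr0n.
have : 0 <= a%:R :> R by [].
have : 0 <= b%:R :> R by [].
move: n2 s_le le_g le_t le_n.
move: n%:R a%:R b%:R g%:R t%:R 'C(n, 2)%:R => N x y G T c.
move=> n2 s_le le_g le_t le_n y0 x0 N0 xy.
(* The minority bound gives [T <= 2 * sigma + 2], and [sigma >= 1]. *)
have {}le_t : T <= 4 * sigma by rewrite -(ler_pM2r N0); nra.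
have yT : y * T <= y * (4 * sigma) by apply: ler_wpM2l.
(* The error [8 * y * T] is at most [32 * sigma * y], hence at most half of the main term
   [N * y]. *)
have ys : y * (64 * sigma) <= y * N by apply: ler_wpM2l.
have Ns : N * 1 <= N * sigma by apply: ler_wpM2l => //; lra.
suff : N * y <= N * (20 * sigma) by rewrite ler_pM2l //; lra.
have ex : x = N - y by lra.
rewrite ex in le_n x0 *.
have yN : y * y <= y * N by apply: ler_wpM2l => //; lra.
nra.
Qed.

(* A constant valid for all [n] *)
From mathcomp Require Import all_classical all_reals all_analysis.
Import numFieldNormedType.Exports.
Local Open Scope classical_set_scope.

Theorem theorem1p7 (R : realType) (s : nat -> R)
  (s_infty : s n @[n --> \oo] --> +oo)
  (s_little_o : s =o_\oo (fun n : nat => n%:R : R)) :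
  exists C : R, forall (n : nat) (A : {set cube n}),
    (0 < n)%N ->
    #|A| = n ->
    #|nbrs A|%:R <= 'C(n, 2)%:R + n%:R * s n ->
    exists w : cube n, n%:R - C * s n <= #|nbr w :&: A|%:R.
Proof.
have [N sN] : exists N, forall n, (N <= n)%N -> 1 <= s n /\ 64 * s n <= n%:R.
  have [N1 _ s_ge1] : \forall n \near \oo, 1 <= s n by move/cvgryPge: s_infty.
  have [N2 _ s_le] : \forall n \near \oo, `|s n| <= 64^-1 * `|n%:R : R|.
    by move/eqoP: s_little_o; apply; rewrite invr_gt0.
  exists (maxn N1 N2) => n; rewrite geq_max => /andP[leN1 leN2].
  split; first exact: s_ge1.
  have := s_le n leN2; rewrite normr_nat => le_s.
  by have := ler_norm (s n); lra.
(* For [n < N] this makes [C * s n >= n], so any [w] works. Absolute values keep the sum nonnegative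
   whatever the signs of the other [s i]. *)
pose small := \sum_(i < N) `|i%:R / s i|.
have small_ge0 : 0 <= small by apply: sumr_ge0.
exists (20 + small) => n A n_gt0 cA le_nbrs; exists (majority A).
have s_gt0 : 0 < s n.
  have := bin2_lt_card_nbrs n_gt0 cA; rewrite -(ltr_nat R) => lt_nbrs.
  have : 0 < n%:R * s n by lra.
  by rewrite pmulr_rgt0 // ltr0n.
have [ltnN|/sN[s_ge1 s_le]] := ltnP n N; last first.
  have := exists_center s_ge1 s_le cA le_nbrs.
  have : 0 <= small * s n by rewrite mulr_ge0 // ltW.
  lra.
have : n%:R / s n <= small.
  rewrite /small (bigD1 (Ordinal ltnN)) //= (le_trans (ler_norm _)) //.
  by rewrite lerDl sumr_ge0.
rewrite ler_pdivrMr // => le_n.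
have : (0 : R) <= #|nbr (majority A) :&: A|%:R by [].
lra.
Qed.
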